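(* Let $H$ be a Hopf algebra over a field $\Bbbk$ and let $A$ be a partial $H$-module algebra with symmetrical partial action. If $r(A)=0$ or $l(A)=0$, then there exists only one minimal globalization of the partial action on $A$ up to isomorphism.
   Context: Algebras are associative $\Bbbk$-algebras, not necessarily unital; $\Delta(h)=\sum h_{(1)}\otimes h_{(2)}$. $r(A)=\{a\in A: ba=0\ \forall b\in A\}$, $l(A)=\{b\in A: ba=0\ \forall a\in A\}$. A partial action of $H$ on $A$ is a linear map $\cdot:H\otimes A\to A$ with, for all $a,b\in A$, $h,k\in H$: $1_H\cdot a=a$ and $h\cdot(a(k\cdot b))=\sum(h_{(1)}\cdot a)(h_{(2)}k\cdot b)$; $A$ is then a partial $H$-module algebra. It is symmetrical if also $h\cdot((k\cdot b)a)=\sum(h_{(1)}k\cdot b)(h_{(2)}\cdot a)$. A (possibly nonunital) $H$-module algebra is an algebra that is a left $H$-module via $\triangleright$ with $h\triangleright(bc)=\sum(h_{(1)}\triangleright b)(h_{(2)}\triangleright c)$. A globalization for a symmetrical partial action $\cdot$ on $A$ is a pair $(B,\theta)$ such that: (1) $B$ is a (possibly nonunital) $H$-module algebra with action $\triangleright$; (2) $\theta:A\to B$ is an injective algebra morphism; (3) $\theta((h\cdot a)b)=(h\triangleright\theta(a))\theta(b)$ and $\theta(b(h\cdot a))=\theta(b)(h\triangleright\theta(a))$ for all $a,b\in A$, $h\in H$; (4) $B=H\triangleright\theta(A)$ (the linear span of all $h\triangleright\theta(a)$); (5) $h\bullet\theta(a)=\theta(h\cdot a)$ defines a partial action of $H$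 on $\theta(A)$. It is minimal if, for all finite families $h_i\in H$, $a_i\in A$, the condition $\sum_i kh_i\cdot a_i=0$ for all $k\in H$ implies $\sum_i h_i\triangleright\theta(a_i)=0$. An isomorphism between globalizations $(B',\theta')$ and $(B,\theta)$ of the same partial action is an isomorphism of $H$-module algebras ($H$-linear algebra isomorphism) $\Phi:B'\to B$ with $\Phi\circ\theta'=\theta$. *)

(* Defs.v *)
From HB Require Import structures.
From mathcomp Require Import all_boot all_order all_algebra sesquilinear.
From mathcomp Require Import boolp classical_sets.

Set Implicit Arguments.
Unset Strict Implicit.
Unset Printing Implicit Defensive.

Import GRing.Theory.
Local Open Scope ring_scope.
Local Open Scope quotient_scope.

(* Tensor products of vector spaces: formal sums of pairs (u, v), represented *)
(* by sequences, modulo the congruence generated by the bilinearity relations.*)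
(* Formal sums are not cancellative, so 0 (x) v = 0 has to be imposed.        *)
Section TensorCongruence.
Variables (k : fieldType) (U V : lmodType k).
Implicit Types (s t : seq (U * V)).

Inductive teq : seq (U * V) -> seq (U * V) -> Prop :=
| teq_refl s : teq s s
| teq_sym s t : teq s t -> teq t s
| teq_trans s t r : teq s t -> teq t r -> teq s r
| teq_cat s s' t t' : teq s s' -> teq t t' -> teq (s ++ t) (s' ++ t')
| teq_catC s t : teq (s ++ t) (t ++ s)
| teq_addl u u' v : teq [:: (u + u', v)] [:: (u, v); (u', v)]
| teq_addr u v v' : teq [:: (u, v + v')] [:: (u, v); (u, v')]
| teq_scale c u v : teq [:: (c *: u, v)] [:: (u, c *: v)]
| teq_zero v : teq [:: (0, v)] [::].

Definition teqb s t : bool := `[< teq s t >].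

Fact teqb_refl : reflexive teqb.
Proof. by move=> s; apply/asboolP; exact: teq_refl. Qed.

Fact teqb_sym : symmetric teqb.
Proof. by move=> s t; apply/asboolP/asboolP; exact: teq_sym. Qed.

Fact teqb_trans : transitive teqb.
Proof.
by move=> t s r /asboolP st /asboolP tr; apply/asboolP; exact: teq_trans st tr.
Qed.

Canonical teq_equiv := EquivRel teqb teqb_refl teqb_sym teqb_trans.

Definition tscale_seq (c : k) s := [seq (c *: p.1, p.2) | p <- s].

Lemma teq_tscale c s t : teq s t -> teq (tscale_seq c s) (tscale_seq c t).
Proof.
elim=> {s t} [s|s t _|s t r _ h _|s s' t t' _ h _ h'|s t|u u' v|u v v'|d u v|v].
- exact: teq_refl.
- exact: teq_sym.
- exact: teq_trans h.
- by rewrite /tscale_seq !map_cat; exact: teq_cat.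
- by rewrite /tscale_seq !map_cat; exact: teq_catC.
- by rewrite /= scalerDr; exact: teq_addl.
- exact: teq_addr.
- by rewrite /= scalerA mulrC -scalerA; exact: teq_scale.
- by rewrite /= scaler0; exact: teq_zero.
Qed.

Lemma teq_tscaleDl c d s :
  teq (tscale_seq (c + d) s) (tscale_seq c s ++ tscale_seq d s).
Proof.
elim: s => [|[u v] s ih]; first exact: teq_refl.
rewrite /= scalerDl -cat1s; apply: teq_trans (teq_cat (teq_addl _ _ _) ih) _.
rewrite -cat1s -catA -[X in teq _ X]cat1s; apply: teq_cat; first exact: teq_refl.
rewrite -[(d *: u, v) :: _ in X in teq _ X]cat1s !catA.
by apply: teq_cat; [exact: teq_catC | exact: teq_refl].
Qed.

Lemma teq_tscale0 s : teq (tscale_seq 0 s) [::].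
Proof.
elim: s => [|[u v] s ih]; first exact: teq_refl.
rewrite /= scale0r -cat1s -[X in teq _ X]cat0s.
exact: teq_cat (teq_zero _) ih.
Qed.

Definition tensor : Type := {eq_quot teq_equiv}.

HB.instance Definition _ := Choice.on tensor.
HB.instance Definition _ := EqQuotient.on tensor.

Implicit Types (x y z : tensor).

Lemma tensorW (P : tensor -> Prop) :
  (forall s, P (\pi_tensor s)) -> forall x, P x.
Proof. by move=> Ppi x; rewrite -[x]reprK; exact: Ppi. Qed.

Lemma tpi_eq s t : teq s t -> \pi_tensor s = \pi_tensor t.
Proof. by move=> st; apply/eqmodP/asboolP. Qed.

Lemma teq_repr s : teq (repr (\pi_tensor s)) s.
Proof. by have /eqmodP/asboolP := reprK (\pi_tensor s). Qed.

Definition tadd x y : tensor := \pi_tensor (repr x ++ repr y).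
Definition tzero : tensor := \pi_tensor [::].
Definition tscale c x : tensor := \pi_tensor (tscale_seq c (repr x)).
Definition topp x := tscale (-1) x.

Lemma taddE s t : tadd (\pi_tensor s) (\pi_tensor t) = \pi_tensor (s ++ t).
Proof. by apply: tpi_eq; apply: teq_cat; exact: teq_repr. Qed.

Lemma tscaleE c s : tscale c (\pi_tensor s) = \pi_tensor (tscale_seq c s).
Proof. by apply: tpi_eq; apply: teq_tscale; exact: teq_repr. Qed.

Fact taddA : associative tadd.
Proof. by elim/tensorW=> s; elim/tensorW=> t; elim/tensorW=> r; rewrite !taddE catA. Qed.

Fact taddC : commutative tadd.
Proof.
by elim/tensorW=> s; elim/tensorW=> t; rewrite !taddE; apply/tpi_eq/teq_catC.
Qed.

Fact tadd0 : left_id tzero tadd.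
Proof. by elim/tensorW=> s; rewrite taddE. Qed.

Fact tscale1 : left_id 1 tscale.
Proof.
elim/tensorW=> s; rewrite tscaleE /tscale_seq; congr (\pi_tensor _).
by rewrite -[RHS]map_id; apply: eq_map => -[u v] /=; rewrite scale1r.
Qed.

Fact tscaleDl x c d : tscale (c + d) x = tadd (tscale c x) (tscale d x).
Proof.
by elim/tensorW: x => s; rewrite !tscaleE taddE; apply/tpi_eq/teq_tscaleDl.
Qed.

Fact taddN : left_inverse tzero topp tadd.
Proof.
move=> x; rewrite /topp -[x in tadd _ x]tscale1 -tscaleDl addNr.
by elim/tensorW: x => s; rewrite tscaleE; apply/tpi_eq/teq_tscale0.
Qed.

HB.instance Definition _ :=
  GRing.isZmodule.Build tensor taddA taddC tadd0 taddN.

Fact tscaleA c d x : tscale c (tscale d x) = tscale (c * d) x.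
Proof.
elim/tensorW: x => s; rewrite !tscaleE /tscale_seq -map_comp.
by congr (\pi_tensor _); apply: eq_map => -[u v] /=; rewrite scalerA.
Qed.

Fact tscaleDr : right_distributive tscale +%R.
Proof.
move=> c; elim/tensorW=> s; elim/tensorW=> t.
by rewrite /GRing.add /= taddE !tscaleE taddE /tscale_seq map_cat.
Qed.

HB.instance Definition _ :=
  GRing.Zmodule_isLmodule.Build k tensor tscaleA tscale1 tscaleDr tscaleDl.

Lemma tpiD s t : \pi_tensor (s ++ t) = \pi_tensor s + \pi_tensor t.
Proof. by rewrite -taddE. Qed.

Lemma tpiZ c s : \pi_tensor (tscale_seq c s) = c *: \pi_tensor s.
Proof. by rewrite -tscaleE. Qed.

Definition pure_tensor (u : U) (v : V) : tensor := \pi_tensor [:: (u, v)].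

Fact pure_tensor_bilinear : bilinear_for *:%R *:%R pure_tensor.
Proof.
split=> [v c u u'|u c v v'] /=; rewrite /pure_tensor.
  by rewrite -tpiZ -tpiD; apply/tpi_eq/teq_addl.
rewrite -tpiZ -tpiD; apply: tpi_eq; apply: teq_trans (teq_addr _ _ _) _.
rewrite -cat1s -[X in teq _ X]cat1s.
by apply: teq_cat; [apply: teq_sym; exact: teq_scale | exact: teq_refl].
Qed.

HB.instance Definition _ := bilinear_isBilinear.Build k U V tensor *:%R *:%R
  pure_tensor pure_tensor_bilinear.

End TensorCongruence.

Notation "u \ox v" := (pure_tensor u v) (at level 40, left associativity).

(* The map U (x) V -> W induced by a bilinear f : U -> V -> W. The chosen     *)
(* representative is irrelevant only when f is bilinear. With                 *)
(* t = comul h, [tlift f t] is the Sweedler sum of the f h_(1) h_(2).         *)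
Definition tlift (k : fieldType) (U V W : lmodType k) (f : U -> V -> W)
    (t : tensor U V) : W :=
  \sum_(p <- repr t) f p.1 p.2.

Section TensorLift.
Variables (k : fieldType) (U V W : lmodType k).

Lemma teq_sum (f : {bilinear U -> V -> W}) s t : teq s t ->
  \sum_(p <- s) f p.1 p.2 = \sum_(p <- t) f p.1 p.2.
Proof.
elim=> {s t} [s|s t _|s t r _ h _|s s' t t' _ h _ h'|s t|u u' v|u v v'|d u v|v] //.
- by rewrite h.
- by rewrite !big_cat h h'.
- by rewrite !big_cat /= addrC.
- by rewrite !big_cons !big_nil !addr0 /= linearDl.
- by rewrite !big_cons !big_nil !addr0 /= linearDr.
- by rewrite !big_cons !big_nil !addr0 /= linearZl linearZr.
- by rewrite !big_cons !big_nil !addr0 /= linear0l.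
Qed.

Lemma tlift_pure (f : {bilinear U -> V -> W}) u v : tlift f (u \ox v) = f u v.
Proof. by rewrite /tlift (teq_sum f (teq_repr _)) big_seq1. Qed.

Lemma tlift_linear (f : {bilinear U -> V -> W}) : linear (tlift f).
Proof.
move=> c; elim/tensorW=> s; elim/tensorW=> t; rewrite -tpiZ -tpiD.
rewrite /tlift !(teq_sum f (teq_repr _)) big_cat /= big_map scaler_sumr.
by congr (_ + _); apply: eq_bigr => p _; rewrite linearZl.
Qed.

End TensorLift.

HB.mixin Record Algebra_isHopf (k : fieldType) H of GRing.Algebra k H := {
  comul : {linear H -> tensor H H};
  counit : {lrmorphism H -> k^o};
  antipode : {linear H -> H};
  comulA : forall h : H,
    tlift (fun h1 h2 => tlift (fun h11 h12 => h11 \ox (h12 \ox h2)) (comul h1))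
      (comul h) =
    tlift (fun h1 h2 => h1 \ox comul h2) (comul h);
  counitl : forall h : H,
    tlift (fun h1 h2 => (counit h1 : k) *: h2) (comul h) = h;
  counitr : forall h : H,
    tlift (fun h1 h2 => (counit h2 : k) *: h1) (comul h) = h;
  comul1 : comul 1 = 1 \ox 1;
  comulM : forall h g : H,
    comul (h * g) =
    tlift (fun h1 h2 => tlift (fun g1 g2 => (h1 * g1) \ox (h2 * g2)) (comul g))
      (comul h);
  antipodel : forall h : H,
    tlift (fun h1 h2 => antipode h1 * h2) (comul h) = (counit h : k) *: 1;
  antipoder : forall h : H,
    tlift (fun h1 h2 => h1 * antipode h2) (comul h) = (counit h : k) *: 1
}.

#[short(type="hopfAlgType")]
HB.structure Definition HopfAlgebra (k : fieldType) :=
  {H of Algebra_isHopf k H & GRing.Algebra k H}.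

HB.mixin Record Lmodule_isNonUnitalAlgebra (k : fieldType) A
    of GRing.Lmodule k A := {
  numul : {bilinear A -> A -> A};
  numulA : associative numul
}.

#[short(type="nuAlgType")]
HB.structure Definition NonUnitalAlgebra (k : fieldType) :=
  {A of Lmodule_isNonUnitalAlgebra k A & GRing.Lmodule k A}.

Notation "a ** b" := (numul a b) (at level 40, left associativity) : ring_scope.

HB.mixin Record isNuMultiplicative (k : fieldType) (A B : nuAlgType k)
    (f : A -> B) := {
  nu_morphM : {morph f : a b / a ** b}
}.

HB.structure Definition NuMorphism (k : fieldType) (A B : nuAlgType k) :=
  {f of isNuMultiplicative k A B f & @GRing.Linear k A B *:%R f}.

Notation "{ 'nualg' A -> B }" := (NuMorphism.type A%type B%type)
  (at level 0, A at level 98, B at level 99,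
   format "{ 'nualg'  A  ->  B }") : type_scope.

Section Image.
Variables (k : fieldType) (A B : nuAlgType k) (f : {nualg A -> B}).

Definition im_pred : {pred B} := fun b => `[< exists a, f a = b >].

Lemma im_predP b : reflect (exists a, f a = b) (b \in im_pred).
Proof. exact: asboolP. Qed.

Fact im_pred_submod : submod_closed im_pred.
Proof.
split; first by apply/im_predP; exists 0; rewrite linear0.
move=> c _ _ /im_predP[a <-] /im_predP[b <-].
by apply/im_predP; exists (c *: a + b); rewrite linearP.
Qed.

HB.instance Definition _ :=
  GRing.isSubmodClosed.Build k B im_pred im_pred_submod.

Record image_alg := ImageAlg { im_val :> B; _ : im_val \in im_pred }.

HB.instance Definition _ := [isSub for im_val].
HB.instance Definition _ := [Choice of image_alg by <:].
HB.instance Definition _ := [SubChoice_isSubLmodule of image_alg by <:].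

Definition to_image (a : A) : image_alg :=
  ImageAlg (introT (im_predP (f a)) (ex_intro _ a erefl)).

Fact im_mul_subproof (x y : image_alg) : im_val x ** im_val y \in im_pred.
Proof.
case: x y => _ /= /im_predP[a <-] [_ /= /im_predP[b <-]].
by apply/im_predP; exists (a ** b); rewrite nu_morphM.
Qed.

Definition im_mul (x y : image_alg) := ImageAlg (im_mul_subproof x y).

Fact im_mul_bilinear : bilinear_for *:%R *:%R im_mul.
Proof.
split=> [z c x y|z c x y]; apply: val_inj.
  by rewrite /= linearPl.
by rewrite /= linearPr.
Qed.

HB.instance Definition _ := bilinear_isBilinear.Build k
  image_alg image_alg image_alg *:%R *:%R im_mul im_mul_bilinear.

Fact im_mulA : associative im_mul.
Proof. by move=> x y z; apply: val_inj; rewrite /= numulA. Qed.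

HB.instance Definition _ := Lmodule_isNonUnitalAlgebra.Build k image_alg im_mulA.

End Image.

Definition left_annihilator (k : fieldType) (A : nuAlgType k) : set A :=
  [set b | forall a : A, b ** a = 0].

Definition right_annihilator (k : fieldType) (A : nuAlgType k) : set A :=
  [set a | forall b : A, b ** a = 0].

Arguments left_annihilator {k} A.
Arguments right_annihilator {k} A.

(* Linear maps H (x) A -> A are given in curried form, as bilinear maps.      *)
Record partial_action (k : fieldType) (H : hopfAlgType k) (A : nuAlgType k)
    (act : {bilinear H -> A -> A}) : Prop := PartialAction {
  pact1 : forall a, act 1 a = a;
  pactM : forall h g a b,
    act h (a ** act g b) =
    tlift (fun h1 h2 => act h1 a ** act (h2 * g) b) (comul h)
}.

Record symmetrical_partial_action (k : fieldType) (H : hopfAlgType k)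
    (A : nuAlgType k) (act : {bilinear H -> A -> A}) : Prop :=
  SymmetricalPartialAction {
  spact_partial : partial_action act;
  spactM : forall h g a b,
    act h (act g b ** a) =
    tlift (fun h1 h2 => act (h1 * g) b ** act h2 a) (comul h)
}.

HB.mixin Record isHModuleAlgebra (k : fieldType) (H : hopfAlgType k) B
    of NonUnitalAlgebra k B := {
  hact : {bilinear H -> B -> B};
  hact1 : forall b : B, hact 1 b = b;
  hactA : forall (h g : H) (b : B), hact (h * g) b = hact h (hact g b);
  hactM : forall (h : H) (b c : B),
    hact h (b ** c) =
    tlift (fun h1 h2 => hact h1 b ** hact h2 c) (comul h)
}.

#[short(type="hmodAlgType")]
HB.structure Definition HModuleAlgebra (k : fieldType) (H : hopfAlgType k) :=
  {B of isHModuleAlgebra k H B & NonUnitalAlgebra k B}.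

Notation "h |> b" := (hact h b) (at level 40, left associativity) : ring_scope.

(* Formed for an arbitrary action [act]; meant for symmetrical partial ones.  *)
(* [glob_induced] says that h . theta(a) := theta(h . a) is a partial action  *)
(* on the subalgebra theta(A) of B.                                           *)
Record globalization (k : fieldType) (H : hopfAlgType k) (A : nuAlgType k)
    (act : {bilinear H -> A -> A}) := Globalization {
  glob_alg :> hmodAlgType H;
  glob_map : {nualg A -> glob_alg};
  glob_inj : injective glob_map;
  glob_actl : forall (h : H) (a b : A),
    glob_map (act h a ** b) = (h |> glob_map a) ** glob_map b;
  glob_actr : forall (h : H) (a b : A),
    glob_map (b ** act h a) = glob_map b ** (h |> glob_map a);
  glob_span : forall x : glob_alg,
    exists n (c : 'I_n -> k) (h : 'I_n -> H) (a : 'I_n -> A),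
      x = \sum_(i < n) c i *: (h i |> glob_map (a i));
  glob_induced : exists2 bul : {bilinear H -> image_alg glob_map ->
                                            image_alg glob_map},
    forall h a, bul h (to_image glob_map a) = to_image glob_map (act h a) &
    partial_action bul
}.

Definition minimal_globalization (k : fieldType) (H : hopfAlgType k)
    (A : nuAlgType k) (act : {bilinear H -> A -> A})
    (G : globalization act) : Prop :=
  forall n (h : 'I_n -> H) (a : 'I_n -> A),
    (forall g : H, \sum_(i < n) act (g * h i) (a i) = 0) ->
    \sum_(i < n) h i |> glob_map G (a i) = 0.

Definition globalization_iso (k : fieldType) (H : hopfAlgType k)
    (A : nuAlgType k) (act : {bilinear H -> A -> A})
    (G' G : globalization act) : Prop :=
  exists Phi : {nualg G' -> G},
    [/\ bijective Phi,
        forall (h : H) (b : G'), Phi (h |> b) = h |> Phi b &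
        forall a : A, Phi (glob_map G' a) = glob_map G a].

(* Main.v *)
(* In the H-module algebra of the linear maps H -> A, under convolution and    *)
(* (h |> f)(g) = f (g h), send a to phi a := (h |-> h . a). Since              *)
(* (h |> x) y = sum h_(1) |> (x (S(h_(2)) |> y)), the span B of the h |> phi a *)
(* is a subalgebra, and (B, phi) is a globalization by symmetry, minimal       *)
(* because maps are determined by their values. In any minimal globalization   *)
(* sum h_i |> theta a_i vanishes exactly when all the sum (g h_i) . a_i do:    *)
(* theta (sum (g h_i) . a_i) kills theta A on one side as soon as              *)
(* sum h_i |> theta a_i = 0, and r(A) = 0 or l(A) = 0 concludes. Hence         *)
(* h |> theta' a |-> h |> theta a is a well-defined isomorphism.               *)
Require Import Defs.
From HB Require Import structures.
From mathcomp Require Import all_boot all_order all_algebra sesquilinear.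
From mathcomp Require Import functions boolp classical_sets.

Import GRing.Theory.
Local Open Scope ring_scope.
Local Open Scope classical_set_scope.

Set Implicit Arguments.
Unset Strict Implicit.
Unset Printing Implicit Defensive.

(** Existence: the two multiplicativity axioms of a symmetrical partial action, read as equalities
    of functions of the acting element, are the compatibilities [orbit_map_actr] and
    [orbit_map_actl] in Hom(H, A); [hact_mull] closes the span of the translates under products.
    Uniqueness: every element of a globalization is the value [hsum] of a formal sum of pairs (h,
    a), and scaling, action and product can be computed on formal sums by rules common to all
    globalizations. By [glob_hsum_eq0], where the annihilators enter, and minimality, the same
    formal sums vanish in all minimal globalizations. Evaluating one formal sum in two of them
    ([transfer]) is then the isomorphism. *)

(** * Calculus of maps induced on tensor products *)

Section TensorLiftTheory.
Variables (k : fieldType).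
Implicit Types (U V W X Y : lmodType k).

(** Bilinearity is taken as a property of a bare function, so that the anonymous functions inside
    Sweedler sums qualify. *)
Lemma tlift_pure_of U V W (f : U -> V -> W) : bilinear_for *:%R *:%R f ->
  forall u v, tlift f (u \ox v) = f u v.
Proof.
move=> fb u v; pose F : {bilinear U -> V -> W} :=
  HB.pack f (bilinear_isBilinear.Build k U V W *:%R *:%R f fb).
exact: (tlift_pure F).
Qed.

Lemma tlift_linear_of U V W (f : U -> V -> W) : bilinear_for *:%R *:%R f ->
  linear (tlift f).
Proof.
move=> fb; pose F : {bilinear U -> V -> W} :=
  HB.pack f (bilinear_isBilinear.Build k U V W *:%R *:%R f fb).
exact: (tlift_linear F).
Qed.

Lemma linear_of_sum U V (f : U -> V) : linear f ->
  forall I (r : seq I) (F : I -> U),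
  f (\sum_(i <- r) F i) = \sum_(i <- r) f (F i).
Proof.
move=> fl I r F; pose G : {linear U -> V} :=
  HB.pack f (GRing.isLinear.Build k U V *:%R f fl).
exact: (linear_sum G).
Qed.

Lemma linear_tlift U V W X (g : W -> X) : linear g ->
  forall (f : U -> V -> W) t, g (tlift f t) = tlift (fun u v => g (f u v)) t.
Proof. by move=> gl f t; rewrite /tlift (linear_of_sum gl). Qed.

Lemma eq_tlift U V W (f g : U -> V -> W) t :
  (forall u v, f u v = g u v) -> tlift f t = tlift g t.
Proof. by move=> fg; apply: eq_bigr => p _. Qed.

Lemma exchange_tlift U V W X Y (f : U -> V -> W -> X -> Y) s t :
  tlift (fun u v => tlift (f u v) t) s =
  tlift (fun w x => tlift (fun u v => f u v w x) s) t.
Proof. exact: exchange_big. Qed.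

Lemma tlift_linear_param U V W X (f : X -> U -> V -> W) :
  (forall u v, linear (fun x => f x u v)) ->
  forall t, linear (fun x => tlift (f x) t).
Proof.
move=> fl t c x y; rewrite /tlift scaler_sumr -big_split.
by apply: eq_bigr => p _; rewrite fl.
Qed.

End TensorLiftTheory.

(** * Sweedler calculus in a Hopf algebra *)

Section Sweedler.
Variables (k : fieldType) (H : hopfAlgType k).
Implicit Types (W : lmodType k).

Lemma tlift_comul_linear W (f : H -> H -> W) : bilinear_for *:%R *:%R f ->
  linear (fun h => tlift f (comul h)).
Proof. by move=> fb c g h; rewrite linearP (tlift_linear_of fb). Qed.

(** A trilinear f induces a linear map on H (x) (H (x) H); apply it to both sides of
    coassociativity. *)
Lemma tlift_comulA W (f : H -> H -> H -> W) :
  (forall h g, linear (fun x => f x h g)) ->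
  (forall h g, linear (fun x => f h x g)) ->
  (forall h g, linear (fun x => f h g x)) ->
  forall h,
  tlift (fun h1 h2 => tlift (fun h11 h12 => f h11 h12 h2) (comul h1)) (comul h) =
  tlift (fun h1 h2 => tlift (fun h21 h22 => f h1 h21 h22) (comul h2)) (comul h).
Proof.
move=> f1 f2 f3 h.
have fb x : bilinear_for *:%R *:%R (f x) by split.
have Fb : bilinear_for *:%R *:%R (fun x => tlift (f x)).
  split=> [t|x]; first exact: tlift_linear_param.
  exact: tlift_linear_of.
have Fl := tlift_linear_of Fb.
have := congr1 (tlift (fun x => tlift (f x))) (comulA h).
rewrite !(linear_tlift Fl) => E.
transitivity (tlift (fun h1 h2 => tlift (fun x => tlift (f x))
  (h1 \ox comul h2)) (comul h)); last first.
  by apply: eq_tlift => h1 h2; rewrite (tlift_pure_of Fb).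
rewrite -E; apply: eq_tlift => h1 h2; rewrite (linear_tlift Fl).
by apply: eq_tlift => h11 h12; rewrite (tlift_pure_of Fb) (tlift_pure_of (fb _)).
Qed.

Lemma tlift_comulM W (f : H -> H -> W) : bilinear_for *:%R *:%R f ->
  forall h g, tlift f (comul (h * g)) =
  tlift (fun h1 h2 => tlift (fun g1 g2 => f (h1 * g1) (h2 * g2)) (comul g))
    (comul h).
Proof.
move=> fb h g; have fl := tlift_linear_of fb.
rewrite comulM (linear_tlift fl); apply: eq_tlift => h1 h2.
rewrite (linear_tlift fl); apply: eq_tlift => g1 g2.
exact: tlift_pure_of.
Qed.

End Sweedler.

(** * Moving the action out of a product by the antipode *)

Section HModuleAlgebraTheory.
Variables (k : fieldType) (H : hopfAlgType k) (B : hmodAlgType H).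

(** Both sides equal the sum of (h_1 |> x) (h_2 S(h_3) |> y): on the left h_2 S(h_3) collapses to a
    counit, on the right the action on the product is expanded, and coassociativity regroups. *)
Lemma hact_mull (h : H) (x y : B) :
  (h |> x) ** y = tlift (fun h1 h2 => h1 |> (x ** (antipode h2 |> y))) (comul h).
Proof.
pose f (h1 h2 h3 : H) : B := (h1 |> x) ** ((h2 * antipode h3) |> y).
transitivity (tlift (fun h1 h2 => tlift (f h1) (comul h2)) (comul h)).
  have xyl : linear (fun z : H => (z |> x) ** y).
    by move=> c u v; rewrite linearPl linearPl.
  rewrite -{1}[h]counitr (linear_tlift xyl).
  apply: eq_tlift => h1 h2.
  have gl : linear (fun z : H => (h1 |> x) ** (z |> y)).
    by move=> c u v; rewrite linearPl linearPr.
  by rewrite -(linear_tlift gl) antipoder !linearZl hact1 linearZr.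
rewrite -(tlift_comulA (f := f)).
- apply: eq_tlift => h1 h2; rewrite hactM; apply: eq_tlift => h11 h12.
  by rewrite /f hactA.
- by move=> h2 h3 c u v; rewrite /f linearPl linearPl.
- by move=> h2 h3 c u v; rewrite /f mulrDl -scalerAl linearPl linearPr.
- move=> h2 h3 c u v; rewrite /f linearP mulrDr -scalerAr.
  by rewrite linearPl linearPr.
Qed.

End HModuleAlgebraTheory.

(** * The convolution algebra Hom(H, A) as an H-module algebra *)

Section ConvolutionAlgebra.
Variables (k : fieldType) (H : hopfAlgType k) (A : nuAlgType k).

Definition linear_pred : {pred H -> A} := fun f => `[< linear f >].

Fact linear_pred_submod : submod_closed linear_pred.
Proof.
split; first by apply/asboolP => c u v; rewrite scaler0 addr0.
move=> c f g /asboolP fl /asboolP gl; apply/asboolP => d u v.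
have E x : (c *: f + g) x = c *: f x + g x by [].
by rewrite !E fl gl !scalerDr !scalerA [c * d]mulrC addrACA.
Qed.

HB.instance Definition _ :=
  GRing.isSubmodClosed.Build k (H -> A) linear_pred linear_pred_submod.

Record conv := Conv { conv_val :> H -> A; conv_valP : conv_val \in linear_pred }.

HB.instance Definition _ := [isSub for conv_val].
HB.instance Definition _ := [Choice of conv by <:].
HB.instance Definition _ := [SubChoice_isSubLmodule of conv by <:].

Lemma convP (f : conv) : linear f.
Proof. exact/asboolP/conv_valP. Qed.

Lemma conv_ext (f g : conv) : f =1 g -> f = g.
Proof. by move=> fg; apply/val_inj/funext. Qed.

Definition mk_conv (f : H -> A) (fl : linear f) : conv :=
  Conv (introT (asboolP (linear f)) fl).

Lemma convDE (c : k) (f g : conv) h : (c *: f + g) h = c *: f h + g h.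
Proof. by []. Qed.

Lemma conv_sumE I (r : seq I) (F : I -> conv) h :
  (\sum_(i <- r) F i) h = \sum_(i <- r) F i h.
Proof. by elim/big_rec2: _ => [|i y z _ <-]. Qed.

Lemma conv_mul_bilin (f g : conv) :
  bilinear_for *:%R *:%R (fun h1 h2 => f h1 ** g h2).
Proof. by split=> [h|h] c u v; rewrite convP (linearPl, linearPr). Qed.

Definition conv_mul (f g : conv) : conv :=
  mk_conv (tlift_comul_linear (conv_mul_bilin f g)).

Fact conv_mul_bilinear : bilinear_for *:%R *:%R conv_mul.
Proof.
split=> [g c f f'|f c g g']; apply: conv_ext => h;
  rewrite convDE scaler_sumr -big_split; apply: eq_bigr => p _ /=.
  by rewrite linearPl.
by rewrite linearPr.
Qed.

HB.instance Definition _ := bilinear_isBilinear.Build k conv conv conv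
  *:%R *:%R conv_mul conv_mul_bilinear.

Fact conv_mulA : associative conv_mul.
Proof.
move=> f g e; apply: conv_ext => h /=.
pose F h1 h2 h3 := f h1 ** (g h2 ** e h3).
transitivity (tlift (fun h1 h2 => tlift (F h1) (comul h2)) (comul h)).
  apply: eq_tlift => h1 h2.
  have fl : linear (fun z => f h1 ** z) by move=> c u v; rewrite linearPr.
  by rewrite (linear_tlift fl).
rewrite -(tlift_comulA (f := F)).
- apply: eq_tlift => h1 h2.
  have el : linear (fun z => z ** e h2) by move=> c u v; rewrite linearPl.
  by rewrite (linear_tlift el); apply: eq_tlift => h11 h12; rewrite /F numulA.
- by move=> h2 h3 c u v; rewrite /F convP linearPl.
- by move=> h2 h3 c u v; rewrite /F convP linearPl linearPr.
- by move=> h2 h3 c u v; rewrite /F convP !linearPr.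
Qed.

HB.instance Definition _ := Lmodule_isNonUnitalAlgebra.Build k conv conv_mulA.

Fact conv_act_linear (h : H) (f : conv) : linear (fun x => f (x * h)).
Proof. by move=> c u v; rewrite mulrDl -scalerAl convP. Qed.

(** Multiplying the argument on the right is what yields a left action. *)
Definition conv_act (h : H) (f : conv) : conv := mk_conv (conv_act_linear h f).

Fact conv_act_bilinear : bilinear_for *:%R *:%R conv_act.
Proof.
split=> [f c h g|h c f g]; apply: conv_ext => x //.
by rewrite convDE /= mulrDr -scalerAr convP.
Qed.

HB.instance Definition _ := bilinear_isBilinear.Build k H conv conv
  *:%R *:%R conv_act conv_act_bilinear.

Fact conv_act1 (f : conv) : conv_act 1 f = f.
Proof. by apply: conv_ext => x /=; rewrite mulr1. Qed.

Fact conv_actA (h g : H) (f : conv) : conv_act (h * g) f = conv_act h (conv_act g f).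
Proof. by apply: conv_ext => x /=; rewrite mulrA. Qed.

(** Since the coproduct is multiplicative, the value at x is a double sum of f (x_1 h_1) g (x_2
    h_2); only the order of summation differs. *)
Fact conv_actM (h : H) (f g : conv) : conv_act h (f ** g) =
  tlift (fun h1 h2 => conv_act h1 f ** conv_act h2 g) (comul h).
Proof.
apply: conv_ext => x /=.
rewrite (tlift_comulM (conv_mul_bilin f g)) exchange_tlift.
by rewrite /tlift conv_sumE.
Qed.

HB.instance Definition _ :=
  isHModuleAlgebra.Build k H conv conv_act1 conv_actA conv_actM.

End ConvolutionAlgebra.

(** * H-stable subalgebras as H-module algebras *)

Section SubHModuleAlgebra.
Variables (k : fieldType) (H : hopfAlgType k) (C : hmodAlgType H).

Record sub_hmod_alg := SubHmodAlg {
  sha_pred : {pred C};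
  sha_submod : submod_closed sha_pred;
  sha_mul : {in sha_pred &, forall x y, x ** y \in sha_pred};
  sha_act : forall h : H, {in sha_pred, forall x, h |> x \in sha_pred}
}.

Variable S : sub_hmod_alg.

HB.instance Definition _ :=
  GRing.isSubmodClosed.Build k C (sha_pred S) (sha_submod S).

Record sha_type := Sha { sha_val :> C; sha_valP : sha_val \in sha_pred S }.

HB.instance Definition _ := [isSub for sha_val].
HB.instance Definition _ := [Choice of sha_type by <:].
HB.instance Definition _ := [SubChoice_isSubLmodule of sha_type by <:].

Definition sha_numul (x y : sha_type) := Sha (sha_mul (sha_valP x) (sha_valP y)).

Fact sha_numul_bilinear : bilinear_for *:%R *:%R sha_numul.
Proof.
by split=> [z c x y|z c x y]; apply: val_inj; rewrite /= (linearPl, linearPr).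
Qed.

HB.instance Definition _ := bilinear_isBilinear.Build k
  sha_type sha_type sha_type *:%R *:%R sha_numul sha_numul_bilinear.

Fact sha_numulA : associative sha_numul.
Proof. by move=> x y z; apply: val_inj; rewrite /= numulA. Qed.

HB.instance Definition _ := Lmodule_isNonUnitalAlgebra.Build k sha_type sha_numulA.

Definition sha_hact h (x : sha_type) := Sha (sha_act h (sha_valP x)).

Fact sha_hact_bilinear : bilinear_for *:%R *:%R sha_hact.
Proof.
by split=> [z c x y|z c x y]; apply: val_inj; rewrite /= (linearPl, linearPr).
Qed.

HB.instance Definition _ := bilinear_isBilinear.Build k
  H sha_type sha_type *:%R *:%R sha_hact sha_hact_bilinear.

Lemma sha_val_linear : linear sha_val.
Proof. by []. Qed.

Fact sha_hact1 (x : sha_type) : sha_hact 1 x = x.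
Proof. by apply: val_inj; rewrite /= hact1. Qed.

Fact sha_hactA (h g : H) (x : sha_type) :
  sha_hact (h * g) x = sha_hact h (sha_hact g x).
Proof. by apply: val_inj; rewrite /= hactA. Qed.

Fact sha_hactM (h : H) (x y : sha_type) : sha_hact h (x ** y) =
  tlift (fun h1 h2 => sha_hact h1 x ** sha_hact h2 y) (comul h).
Proof. by apply: val_inj; rewrite /= (linear_tlift sha_val_linear) hactM. Qed.

HB.instance Definition _ :=
  isHModuleAlgebra.Build k H sha_type sha_hact1 sha_hactA sha_hactM.

End SubHModuleAlgebra.

(** * Formal sums of pairs (h, a) and their values *)

Section ActionSums.
Variables (k : fieldType) (H : hopfAlgType k) (A : nuAlgType k).
Variable act : {bilinear H -> A -> A}.
Implicit Types (s t : seq (H * A)).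

(** The sequence stands for a formal sum of h (x) a, with scalars absorbed into h. It does not
    mention B, so it can be evaluated in several globalizations. *)
Definition hsum (B : hmodAlgType H) (f : A -> B) s : B :=
  \sum_(p <- s) p.1 |> f p.2.

Definition seq_scale (c : k) s := [seq (c *: p.1, p.2) | p <- s].

Definition seq_act (h : H) s := [seq (h * p.1, p.2) | p <- s].

(* The product of the corresponding sums, after hact_mull, in a form that does *)
(* not depend on the globalization.                                            *)
Definition seq_mul s t : seq (H * A) :=
  flatten [seq flatten [seq [seq (r.1, p.2 ** act (antipode r.2 * q.1) q.2)
    | r <- repr (comul p.1)] | q <- t] | p <- s].

Section HSum.
Variables (B : hmodAlgType H) (f : A -> B).

Lemma hsum_cat s t : hsum f (s ++ t) = hsum f s + hsum f t.
Proof. exact: big_cat. Qed.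

Lemma hsum_scale c s : hsum f (seq_scale c s) = c *: hsum f s.
Proof.
rewrite /hsum big_map scaler_sumr; apply: eq_bigr => p _ /=.
by rewrite linearZl.
Qed.

Lemma hsum_act h s : hsum f (seq_act h s) = h |> hsum f s.
Proof.
rewrite /hsum big_map linear_sumr; apply: eq_bigr => p _ /=.
by rewrite hactA.
Qed.

(** After [hact_mull], each term has the form r_1 |> (f a ** (S(r_2) g |> f b)), and the
    compatibility of f turns the inner product into a single value of f. *)
Lemma hsum_mul :
  (forall h a b, f (b ** act h a) = f b ** (h |> f a)) ->
  forall s t, hsum f (seq_mul s t) = hsum f s ** hsum f t.
Proof.
move=> fr s t; rewrite /hsum big_flatten big_map linear_sumlz.
apply: eq_bigr => p _; rewrite big_flatten big_map linear_sumr.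
apply: eq_bigr => q _; rewrite big_map hact_mull.
by apply: eq_bigr => r _ /=; rewrite fr hactA.
Qed.

Definition hspan : {pred B} := fun x => `[< exists s, hsum f s = x >].

Lemma hspanP x : reflect (exists s, hsum f s = x) (x \in hspan).
Proof. exact: asboolP. Qed.

Fact hspan_submod : submod_closed hspan.
Proof.
split; first by apply/hspanP; exists [::]; rewrite /hsum big_nil.
move=> c _ _ /hspanP[s <-] /hspanP[t <-]; apply/hspanP.
by exists (seq_scale c s ++ t); rewrite hsum_cat hsum_scale.
Qed.

Fact hspan_act h : {in hspan, forall x, h |> x \in hspan}.
Proof.
by move=> _ /hspanP[s <-]; apply/hspanP; exists (seq_act h s); rewrite hsum_act.
Qed.

Hypothesis fr : forall h a b, f (b ** act h a) = f b ** (h |> f a).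

Fact hspan_mul : {in hspan &, forall x y, x ** y \in hspan}.
Proof.
move=> _ _ /hspanP[s <-] /hspanP[t <-]; apply/hspanP.
by exists (seq_mul s t); rewrite hsum_mul.
Qed.

Definition hspan_alg : sub_hmod_alg B :=
  SubHmodAlg hspan_submod hspan_mul hspan_act.

End HSum.
End ActionSums.

(** * Transport of the partial action to the image *)

Section InducedAction.
Variables (k : fieldType) (H : hopfAlgType k) (A B : nuAlgType k).
Variables (act : {bilinear H -> A -> A}) (f : {nualg A -> B}).
Hypotheses (finj : injective f) (pact : partial_action act).

Lemma to_image_linear : linear (to_image f).
Proof. by move=> c x y; apply: val_inj; rewrite /= linearP. Qed.

Lemma to_imageM : {morph to_image f : x y / x ** y}.
Proof. by move=> x y; apply: val_inj; rewrite /= nu_morphM. Qed.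

Lemma to_image_inj : injective (to_image f).
Proof. by move=> x y /(congr1 val); exact: finj. Qed.

Lemma to_image_surj (y : image_alg f) : exists x, to_image f x = y.
Proof.
by case: y => b hb; have /im_predP[a fa] := hb; exists a; apply: val_inj.
Qed.

Lemma induced_action : exists2 bul : {bilinear H -> image_alg f -> image_alg f},
  forall h a, bul h (to_image f a) = to_image f (act h a) & partial_action bul.
Proof.
(* Injectivity of f makes this choice of preimages a two-sided inverse of [to_image f], so the
   partial action can be transported. *)
pose pre y := sval (cid (to_image_surj y)).
have preK y : to_image f (pre y) = y by exact: (svalP (cid (to_image_surj y))).
have toK a : pre (to_image f a) = a by apply: to_image_inj.
pose bul h y := to_image f (act h (pre y)).
have bulE h a : bul h (to_image f a) = to_image f (act h a) by rewrite /bul toK.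
have bulb : bilinear_for *:%R *:%R bul.
  split=> [y c h g|h c x y]; rewrite /bul -to_image_linear.
    by rewrite linearPl.
  by rewrite -{1}[x]preK -{1}[y]preK -to_image_linear toK linearPr.
exists (HB.pack_for {bilinear H -> image_alg f -> image_alg f} bul
  (bilinear_isBilinear.Build k H _ _ *:%R *:%R bul bulb)) => //=.
split=> /= [y|h g x y]; first by rewrite -[y]preK bulE (pact1 pact).
rewrite -[x]preK -[y]preK bulE -to_imageM bulE (pactM pact).
rewrite (linear_tlift to_image_linear); apply: eq_tlift => h1 h2.
by rewrite !bulE to_imageM.
Qed.

End InducedAction.

(** * The minimal globalization inside Hom(H, A) *)

Section StandardGlobalization.
Variables (k : fieldType) (H : hopfAlgType k) (A : nuAlgType k).
Variable act : {bilinear H -> A -> A}.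
Hypothesis sp : symmetrical_partial_action act.

Fact orbit_map_subproof (a : A) : linear (act^~ a).
Proof. by move=> c g h; rewrite linearPl. Qed.

Definition orbit_map (a : A) : conv H A := mk_conv (orbit_map_subproof a).

Lemma orbit_map_actr h a b :
  orbit_map (b ** act h a) = orbit_map b ** (h |> orbit_map a).
Proof. by apply: conv_ext => g /=; rewrite (pactM (spact_partial sp)). Qed.

Lemma orbit_map_actl h a b :
  orbit_map (act h a ** b) = (h |> orbit_map a) ** orbit_map b.
Proof. by apply: conv_ext => g /=; rewrite (spactM sp). Qed.

(** This is the case h = 1 of [orbit_map_actr]. *)
Lemma orbit_mapM : {morph orbit_map : a b / a ** b}.
Proof.
move=> a b; rewrite -{1}[b](pact1 (spact_partial sp)) orbit_map_actr.
by rewrite hact1.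
Qed.

Lemma orbit_map_linear : linear orbit_map.
Proof. by move=> c a b; apply: conv_ext => h; rewrite convDE /= linearPr. Qed.

Lemma orbit_map_inj : injective orbit_map.
Proof.
move=> a b /(congr1 (fun f : conv H A => f 1)) /=.
by rewrite !(pact1 (spact_partial sp)).
Qed.

Definition std_alg := sha_type (hspan_alg orbit_map_actr).

HB.instance Definition _ := HModuleAlgebra.on std_alg.

Fact std_map_subproof a : orbit_map a \in hspan orbit_map.
Proof. by apply/hspanP; exists [:: (1, a)]; rewrite /hsum big_seq1 hact1. Qed.

Definition std_map (a : A) : std_alg :=
  Sha (S := hspan_alg orbit_map_actr) (std_map_subproof a).

Fact std_map_linear : linear std_map.
Proof. by move=> c a b; apply: val_inj; rewrite /= orbit_map_linear. Qed.

HB.instance Definition _ := GRing.isLinear.Build k A std_alg *:%R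
  std_map std_map_linear.

Fact std_mapM : {morph std_map : a b / a ** b}.
Proof. by move=> a b; apply: val_inj; rewrite /= orbit_mapM. Qed.

HB.instance Definition _ := isNuMultiplicative.Build k A std_alg std_map std_mapM.

Lemma std_map_inj : injective std_map.
Proof. by move=> a b /(congr1 val); exact: orbit_map_inj. Qed.

Lemma std_actl (h : H) (a b : A) :
  std_map (act h a ** b) = (h |> std_map a) ** std_map b.
Proof. by apply: val_inj; rewrite /= orbit_map_actl. Qed.

Lemma std_actr (h : H) (a b : A) :
  std_map (b ** act h a) = std_map b ** (h |> std_map a).
Proof. by apply: val_inj; rewrite /= orbit_map_actr. Qed.

Lemma std_span (x : std_alg) :
  exists n (c : 'I_n -> k) (h : 'I_n -> H) (a : 'I_n -> A),
    x = \sum_(i < n) c i *: (h i |> std_map (a i)).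
Proof.
have /hspanP[s sx] := sha_valP x.
(* The coefficients can all be 1 because formal sums carry their scalars in the H component. *)
exists (size s), (fun=> 1), (fun i => (tnth (in_tuple s) i).1),
  (fun i => (tnth (in_tuple s) i).2); apply: val_inj.
rewrite -[LHS]sx [RHS](linear_of_sum (@sha_val_linear _ _ _ _)).
rewrite /hsum big_tnth.
by apply: eq_bigr => i _; rewrite scale1r.
Qed.

Definition std_globalization : globalization act :=
  Globalization std_map_inj std_actl std_actr std_span
    (induced_action std_map_inj (spact_partial sp)).

(** The sum of the h_i |> phi a_i is the function g |-> sum (g h_i) . a_i, so the premise of
    minimality says that it vanishes pointwise. *)
Lemma std_minimal : minimal_globalization std_globalization.
Proof.
move=> n h a ha0; apply: val_inj.
apply: etrans (linear_of_sum (@sha_val_linear _ _ _ _) _ _) _.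
by apply: conv_ext => g; rewrite conv_sumE; exact: ha0.
Qed.

End StandardGlobalization.

(** * Comparison of minimal globalizations *)

Section Uniqueness.
Variables (k : fieldType) (H : hopfAlgType k) (A : nuAlgType k).
Variable act : {bilinear H -> A -> A}.
Hypothesis ann0 : right_annihilator A = [set 0] \/ left_annihilator A = [set 0].
Implicit Types (G : globalization act) (s t : seq (H * A)).

Lemma glob_hsum_surj G (x : G) : exists s, hsum (glob_map G) s = x.
Proof.
have [n [c [h [a ->]]]] := glob_span x.
exists [seq (c i *: h i, a i) | i <- index_enum 'I_n].
by rewrite /hsum big_map; apply: eq_bigr => i _; rewrite /= linearZl.
Qed.

(** The converse of the minimality condition. Acting by g and multiplying by theta b on either side
    still gives 0; the compatibilities rewrite these products as theta (a ** b) and theta (b ** a),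
    so a lies in both annihilators, one of which is trivial. *)
Lemma glob_hsum_eq0 G s : hsum (glob_map G) s = 0 ->
  forall g, \sum_(p <- s) act (g * p.1) p.2 = 0.
Proof.
move=> s0 g; set a := \sum_(p <- s) _.
have gs0 : \sum_(p <- s) (g * p.1) |> glob_map G p.2 = 0.
  by have := hsum_act (glob_map G) g s; rewrite s0 linear0r /hsum big_map.
have al b : a ** b = 0.
  apply: (@glob_inj _ _ _ _ G); rewrite linear0 linear_sumlz linear_sum.
  rewrite (eq_bigr _ (fun p _ => glob_actl G (g * p.1) p.2 b)).
  by rewrite -linear_sumlz gs0 linear0l.
have ar b : b ** a = 0.
  apply: (@glob_inj _ _ _ _ G); rewrite linear0 linear_sumr linear_sum.
  rewrite (eq_bigr _ (fun p _ => glob_actr G (g * p.1) p.2 b)).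
  by rewrite -linear_sumr gs0 linear0r.
case: ann0 => E.
  by have : right_annihilator A a by []; rewrite E.
by have : left_annihilator A a by []; rewrite E.
Qed.

Lemma minimal_hsum_eq0 G s : minimal_globalization G ->
  (forall g, \sum_(p <- s) act (g * p.1) p.2 = 0) -> hsum (glob_map G) s = 0.
Proof.
move=> Gm s0; rewrite /hsum big_tnth; apply: Gm => g.
by have := s0 g; rewrite big_tnth.
Qed.

(** The formal difference of s and t vanishes in G', hence satisfies the intrinsic condition of
    [glob_hsum_eq0], hence vanishes in G by minimality. *)
Lemma hsum_transfer G G' s t : minimal_globalization G ->
  hsum (glob_map G') s = hsum (glob_map G') t ->
  hsum (glob_map G) s = hsum (glob_map G) t.
Proof.
move=> Gm st; apply/eqP; rewrite -subr_eq0 addrC -scaleN1r.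
rewrite -hsum_scale -hsum_cat; apply/eqP/(minimal_hsum_eq0 Gm).
apply: (@glob_hsum_eq0 G').
by rewrite hsum_cat hsum_scale st scaleN1r addNr.
Qed.

(** The representing sequence is an arbitrary choice; for minimal G, [hsum_transfer] makes the
    result independent of it. *)
Definition transfer G' G (x : G') : G :=
  hsum (glob_map G) (sval (cid (glob_hsum_surj x))).

Lemma transfer_hsum G' G s : minimal_globalization G ->
  transfer G (hsum (glob_map G') s) = hsum (glob_map G) s.
Proof.
by move=> Gm; apply: (hsum_transfer Gm); exact: (svalP (cid (glob_hsum_surj _))).
Qed.

Lemma transferK G' G : minimal_globalization G' -> minimal_globalization G ->
  cancel (@transfer G' G) (@transfer G G').
Proof.
by move=> Gm' Gm x; have [s <-] := glob_hsum_surj x; rewrite !transfer_hsum.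
Qed.

Lemma minimal_globalization_iso G' G :
  minimal_globalization G' -> minimal_globalization G -> globalization_iso G' G.
Proof.
move=> Gm' Gm.
have Tl : linear (@transfer G' G).
  move=> c x y.
  have [s <-] := glob_hsum_surj x; have [t <-] := glob_hsum_surj y.
  rewrite -hsum_scale -hsum_cat !transfer_hsum //.
  by rewrite hsum_cat hsum_scale.
have TM : {morph @transfer G' G : x y / x ** y}.
  move=> x y.
  have [s <-] := glob_hsum_surj x; have [t <-] := glob_hsum_surj y.
  (* The same sequence [seq_mul act s t] represents the product in G' and in G. *)
  rewrite -(hsum_mul (@glob_actr _ _ _ _ G')) !transfer_hsum //.
  exact: (hsum_mul (@glob_actr _ _ _ _ G)).
exists (HB.pack_for {nualg G' -> G} (@transfer G' G)
  (GRing.isLinear.Build k G' G *:%R _ Tl)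
  (isNuMultiplicative.Build k G' G _ TM)); split=> /=.
- by exists (@transfer G G'); exact: transferK.
- move=> h x; have [s <-] := glob_hsum_surj x.
  by rewrite -hsum_act !transfer_hsum // hsum_act.
(* In every globalization theta a = 1 |> theta a, so one formal sum represents it in both. *)
- move=> a; have E G0 : glob_map G0 a = hsum (glob_map G0) [:: (1, a)].
    by rewrite /hsum big_seq1 hact1.
  by rewrite !E transfer_hsum.
Qed.

End Uniqueness.

Unset Implicit Arguments.

Theorem corollary44 (k : fieldType) (H : hopfAlgType k) (A : nuAlgType k)
    (act : {bilinear H -> A -> A}) :
  symmetrical_partial_action act ->
  right_annihilator A = [set 0] \/ left_annihilator A = [set 0] ->
  exists2 G : globalization act,
    minimal_globalization G &
    forall G' : globalization act,
      minimal_globalization G' -> globalization_iso G' G.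
Proof.
move=> sp ann0; exists (std_globalization sp); first exact: std_minimal.
by move=> G' Gm'; apply: minimal_globalization_iso => //; exact: std_minimal.
Qed.
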